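(* Define a relation $<_F$ on the ring of Fermat reals ${}^\bullet\mathbb{R}$ as follows: for distinct $x,y\in{}^\bullet\mathbb{R}$, $x<_F y$ if and only if at least one of the following holds: (a) there exists $l\in{}^\bullet\mathbb{R}$ such that $x\in\{k\in{}^\bullet\mathbb{R} : k\le l\}$ and $y\notin\{k\in{}^\bullet\mathbb{R} : k\le l\}$; (b) $x=\max\{k\in{}^\bullet\mathbb{R} : k\le l\}$ for some $l\in{}^\bullet\mathbb{R}$, and there exists $h\in{}^\bullet\mathbb{R}$ with $h>0$ and $y=x+h$; (c) $y=\min\{k\in{}^\bullet\mathbb{R} : l\le k\}$ for some $l\in{}^\bullet\mathbb{R}$, and there exists $h\in{}^\bullet\mathbb{R}$ with $h>0$ and $x=y-h$. Then $({}^\bullet\mathbb{R},<_F)$ is a linearly ordered set.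
   Context: A little-oh polynomial is a function $x:\mathbb{R}_{\ge0}\to\mathbb{R}$, $t\mapsto x_t=x(t)$, such that $x_t=r+\sum_{i=1}^k\alpha_i t^{a_i}+o(t)$ as $t\to0^+$, for suitable $k\in\mathbb{N}$, $r,\alpha_1,\dots,\alpha_k\in\mathbb{R}$ and $a_1,\dots,a_k\in\mathbb{R}_{\ge0}$. The set of all little-oh polynomials is denoted $\mathbb{R}_o[t]$. For $x,y\in\mathbb{R}_o[t]$, put $x\sim y$ (also written ''$x=y$ in ${}^\bullet\mathbb{R}$'') if and only if $x(t)=y(t)+o(t)$ as $t\to0^+$; this is an equivalence relation. The ring of Fermat reals is ${}^\bullet\mathbb{R}:=\mathbb{R}_o[t]/\!\sim$, with operations induced by the pointwise operations on representatives. The order $\le$ on ${}^\bullet\mathbb{R}$ (Giordano's order) is defined, in terms of representatives (and independently of their choice), by: $x\le y$ if and only if there exists $z$ with $z=0$ in ${}^\bullet\mathbb{R}$ (i.e. $\lim_{t\to0^+}z_t/t=0$) such that for every $t\ge0$ sufficiently small, $x_t\le y_t+z_t$. Here $h>0$ means $0\le h$ and $h\neq0$ in ${}^\bullet\mathbb{R}$; $\max$ and $\min$ are taken with respect to $\le$. *)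

(* Defs.v *)
From HB Require Import structures.
From mathcomp Require Import all_boot all_order all_algebra.
From mathcomp Require Import all_classical all_reals all_analysis.
From mathcomp Require Import ring.
Set Implicit Arguments.
Unset Strict Implicit.
Unset Printing Implicit Defensive.
Import Order.TTheory GRing.Theory Num.Theory.
Import numFieldNormedType.Exports.
Local Open Scope classical_set_scope.
Local Open Scope ring_scope.
Local Open Scope quotient_scope.

(* The filter t -> 0+ on the half-line [0, +oo[, encoded as {nonneg R}; 0 itself
   is not among the points approached, so values at t = 0 are irrelevant. *)
Definition zero_right (R : realType) : set_system {nonneg R} :=
  filter_from (nbhs (0 : R)^'+) (fun A => [set t | A t%:num]).

Definition is_littleo_t (R : realType) (f : {nonneg R} -> R) : Prop :=
  f t / t%:num @[t --> @zero_right R] --> (0 : R).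

Definition is_littleoh_poly (R : realType) (x : {nonneg R} -> R) : Prop :=
  exists (k : nat) (r : R) (alpha a : 'I_k -> R),
    (forall i, 0 <= a i) /\
    is_littleo_t (fun t => x t - (r + \sum_(i < k) alpha i * t%:num `^ a i)).

Section filter.
Variable R : realType.
Local Notation F := (@zero_right R).

#[global] Instance zero_right_filter : ProperFilter F.
Proof.
apply: filter_from_proper; first apply: filter_from_filter.
- by exists setT; exact: filterT.
- move=> A B FA FB; exists (A `&` B); first exact: filterI.
  by move=> t [].
move=> A FA.
have : (0 : R)^'+ (A `&` [set t | 0 < t]).
  by apply: filterI => //; exact: nbhs_right_gt.
move=> /filter_ex[t [At t0]].
by exists (NngNum (ltW t0)).
Qed.

Lemma cvg_zero_right (f : R -> R) (l : R) :
  f t @[t --> 0^'+] --> l -> f t%:num @[t --> F] --> l.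
Proof. by move=> fl A /fl fA; exists (f @^-1` A). Qed.

Lemma zero_right_gt0 : \forall t \near F, 0 < t%:num.
Proof. by exists [set t | 0 < t] => //=; exact: nbhs_right_gt. Qed.

Lemma cvg_num : (t%:num : R) @[t --> F] --> (0 : R).
Proof.
apply: (@cvg_zero_right id); apply: cvg_at_right_filter; exact: cvg_id.
Qed.

Lemma littleo_tB (f g : {nonneg R} -> R) :
  is_littleo_t f -> is_littleo_t g -> is_littleo_t (f - g).
Proof.
move=> f0 g0; rewrite /is_littleo_t -[0 : R]subr0.
rewrite (_ : (fun _ => _) = fun t => f t / t%:num - g t / t%:num).
  exact: cvgB.
by apply/funext => t; rewrite !fctE mulrBl.
Qed.

Lemma littleo_tMr (f g : {nonneg R} -> R) (l : R) :
  is_littleo_t f -> g t @[t --> F] --> l -> is_littleo_t (f * g).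
Proof.
move=> f0 gl; rewrite /is_littleo_t -[0 : R](mul0r l).
rewrite (_ : (fun _ => _) = fun t => f t / t%:num * g t).
  exact: cvgM.
by apply/funext => t; rewrite !fctE mulrAC.
Qed.

Lemma littleo_t_cvg0 (f : {nonneg R} -> R) :
  is_littleo_t f -> f t @[t --> F] --> (0 : R).
Proof.
move=> f0; have := cvgM f0 cvg_num; rewrite mulr0 => /(_ _) h.
apply: (cvg_trans _ h); apply: near_eq_cvg.
near=> t; rewrite /= divfK // gt_eqF //; near: t; exact: zero_right_gt0.
Unshelve. all: by end_near. Qed.

Definition peval (s : seq (R * R)) (t : {nonneg R}) : R :=
  \sum_(p <- s) p.1 * t%:num `^ p.2.

Lemma littleoh_polyP (x : {nonneg R} -> R) :
  is_littleoh_poly x <->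
  exists2 s : seq (R * R), (forall p, p \in s -> 0 <= p.2) &
    is_littleo_t (x - peval s).
Proof.
split=> [[k [r [al [a [a0 xo]]]]]|[s s0 xo]].
  exists ((r, 0) :: [seq (al i, a i) | i <- index_enum 'I_k]).
    by move=> p; rewrite inE => /orP[/eqP-> //|/mapP[i _ ->]]; exact: a0.
  move: xo; congr is_littleo_t; apply/funext => t.
  by rewrite /peval !fctE big_cons big_map /= powRr0 mulr1.
exists (size s), 0, (fun i => (tnth (in_tuple s) i).1),
  (fun i => (tnth (in_tuple s) i).2); split.
  by move=> i; apply: s0; exact: mem_tnth.
move: xo; congr is_littleo_t; apply/funext => t.
by rewrite /peval !fctE add0r [in LHS]big_tnth.
Qed.

Lemma cvg_peval s : (forall p, p \in s -> 0 <= p.2) ->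
  exists l : R, peval s t @[t --> F] --> l.
Proof.
elim: s => [|p s IH] s0.
  exists 0; rewrite (_ : peval [::] = cst 0); first exact: cvg_cst.
  by apply/funext => t; rewrite /peval big_nil.
have [|l sl] := IH; first by move=> q qs; apply: s0; rewrite inE qs orbT.
have [m pm] : exists m : R, (t%:num `^ p.2 : R) @[t --> F] --> m.
  have := s0 p (mem_head _ _); rewrite le_eqVlt => /orP[/eqP<-|p0].
    by exists 1; under eq_fun do rewrite powRr0; exact: cvg_cst.
  exists 0; apply: (@cvg_zero_right (fun t => t `^ p.2)); exact: powR_cvg0.
exists (p.1 * m + l).
rewrite (_ : peval _ = fun t => p.1 * t%:num `^ p.2 + peval s t).
  by apply: cvgD => //; apply: cvgM => //; exact: cvg_cst.
by apply/funext => t; rewrite /peval big_cons.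
Qed.

Lemma cvg_littleoh_poly (x : {nonneg R} -> R) : is_littleoh_poly x ->
  exists l : R, x t @[t --> F] --> l.
Proof.
move=> /littleoh_polyP[s s0 /littleo_t_cvg0 xo].
have [l sl] := cvg_peval s0; exists (0 + l).
rewrite (_ : x = (x - peval s) + peval s); last by rewrite subrK.
exact: cvgD.
Qed.

End filter.

Definition littleoh_poly_pred (R : realType) : {pred {nonneg R} -> R} :=
  fun x => `[< is_littleoh_poly x >].

Lemma littleoh_poly_subring_closed (R : realType) :
  GRing.subring_closed (@littleoh_poly_pred R).
Proof.
split.
- apply/asboolP/littleoh_polyP; exists [:: (1, 0)].
    by move=> p; rewrite inE => /eqP->.
  rewrite (_ : _ - _ = 0).
    by rewrite /is_littleo_t; under eq_fun do rewrite mul0r; exact: cvg_cst.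
  apply/funext => t; rewrite /peval !fctE big_seq1 /= powRr0 mulr1 subrr.
  by [].
- move=> x y /asboolP/littleoh_polyP[s s0 xs] /asboolP/littleoh_polyP[u u0 yu].
  apply/asboolP/littleoh_polyP; exists (s ++ [seq (- p.1, p.2) | p <- u]).
    move=> p; rewrite mem_cat => /orP[/s0//|/mapP[q qu ->]]; exact: (u0 q).
  have := littleo_tB xs yu; congr is_littleo_t; apply/funext => t.
  rewrite /peval !fctE big_cat big_map /=.
  under [X in _ = x t - y t - (_ + X)]eq_bigr do rewrite mulNr.
  by rewrite sumrN !opprD !opprK addrACA.
- move=> x y /[dup] /asboolP xP /asboolP/littleoh_polyP[s s0 xs].
  move=> /[dup] /asboolP yP /asboolP/littleoh_polyP[u u0 yu].
  apply/asboolP/littleoh_polyP.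
  exists [seq (p.1 * q.1, p.2 + q.2) | p <- s, q <- u].
    move=> _ /allpairsP[[p q] /= [ps qu ->]] /=.
    by rewrite addr_ge0 ?(s0 p) ?(u0 q).
  have [ly yl] := cvg_littleoh_poly yP.
  have [ls sl] := cvg_peval s0.
  have h1 := littleo_tMr xs yl.
  have h2 := littleo_tMr yu sl.
  have h3 : is_littleo_t (0 - (y - peval u) * peval s).
    apply: littleo_tB => //.
    by rewrite /is_littleo_t; under eq_fun do rewrite mul0r; exact: cvg_cst.
  apply: (cvg_trans _ (littleo_tB h1 h3)); apply: near_eq_cvg.
  near=> t; congr (_ / _); rewrite !fctE.
  have -> : peval [seq (p.1 * q.1, p.2 + q.2) | p <- s, q <- u] t =
            peval s t * peval u t.
    rewrite /peval big_allpairs_dep big_distrl /=; apply: eq_bigr => p _.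
    rewrite big_distrr /=; apply: eq_bigr => q _.
    rewrite powRD; first by rewrite mulrACA.
    apply/implyP => _; rewrite gt_eqF.
      by [].
    by near: t; exact: zero_right_gt0.
  by rewrite -[(0 : {nonneg R} -> R) t]/(0 : R) /=; ring.
Unshelve. all: by end_near. Qed.

Record littleoh_poly (R : realType) := LittleohPoly {
  littleoh_poly_fun :> {nonneg R} -> R;
  littleoh_poly_subproof : littleoh_poly_fun \in @littleoh_poly_pred R }.

HB.instance Definition _ (R : realType) :=
  [isSub for @littleoh_poly_fun R].
HB.instance Definition _ (R : realType) := [Choice of littleoh_poly R by <:].
HB.instance Definition _ (R : realType) :=
  GRing.SubChoice_isSubComPzRing.Build ({nonneg R} -> R)
    (@littleoh_poly_pred R) (littleoh_poly R)
    (@littleoh_poly_subring_closed R).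

Lemma littleoh_poly_oner_neq0 (R : realType) : (1 : littleoh_poly R) != 0.
Proof.
apply/eqP => /(congr1 (fun x : littleoh_poly R => x 0%:nng)) /eqP.
by rewrite /= oner_eq0.
Qed.

HB.instance Definition _ (R : realType) :=
  GRing.PzSemiRing_isNonZero.Build (littleoh_poly R)
    (@littleoh_poly_oner_neq0 R).

Definition littleo_t (R : realType) : {pred littleoh_poly R} :=
  fun z => `[< is_littleo_t z >].

Lemma littleo_t_idealr_closed (R : realType) : idealr_closed (@littleo_t R).
Proof.
have o0 : is_littleo_t (0 : littleoh_poly R).
  by rewrite /is_littleo_t; under eq_fun do rewrite mul0r; exact: cvg_cst.
split.
- exact/asboolP.
- apply/asboolP => /littleo_t_cvg0 h.
  have h1 : (1 : R) @[t --> @zero_right R] --> (1 : R) by exact: cvg_cst.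
  have : (1 : R) = 0 by apply: (cvg_unique _ h1 h); exact: norm_hausdorff.
  by move/eqP; rewrite oner_eq0.
- move=> a u v /asboolP uo /asboolP vo; apply/asboolP.
  have [l al] := cvg_littleoh_poly (asboolW (valP a)).
  have := littleo_tB (littleo_tMr uo al) (littleo_tB o0 vo).
  congr is_littleo_t; apply/funext => t; rewrite !fctE /= sub0r opprK mulrC.
  by [].
Qed.

HB.instance Definition _ (R : realType) :=
  isIdealr.Build (littleoh_poly R) (@littleo_t R) (@littleo_t_idealr_closed R).

(* The functions that are o(t) form an ideal of the ring of little-oh
   polynomials under the pointwise operations, and congruence modulo this ideal
   is the relation x(t) = y(t) + o(t) (pi_fermat_eq below). *)
Definition fermat (R : realType) : Type := {ideal_quot @littleo_t R}.
HB.instance Definition _ (R : realType) := GRing.ComNzRing.on (fermat R).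
HB.instance Definition _ (R : realType) := EqQuotient.on (fermat R).
HB.instance Definition _ (R : realType) := NzRingQuotient.on (fermat R).

Lemma pi_fermat_eq (R : realType) (x y : littleoh_poly R) :
  \pi_(fermat R) x = \pi_(fermat R) y <->
  is_littleo_t (fun t => x t - y t).
Proof.
split=> [/eqP|h]; last apply/eqP; rewrite -[_ == _]Quotient.idealrBE.
  by move=> /asboolP.
exact/asboolP.
Qed.

Definition littleoh_poly_le (R : realType) (x y : littleoh_poly R) : Prop :=
  exists z : littleoh_poly R, \pi_(fermat R) z = 0 /\
    exists2 e : R, 0 < e &
      forall t : {nonneg R}, t%:num < e -> x t <= y t + z t.

(* The choice of representatives is immaterial, see fermat_le_pi. *)
Definition fermat_le (R : realType) (x y : fermat R) : Prop :=
  littleoh_poly_le (repr x) (repr y).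

Lemma fermat_le_pi (R : realType) (x y : littleoh_poly R) :
  fermat_le (\pi_(fermat R) x) (\pi_(fermat R) y) <-> littleoh_poly_le x y.
Proof.
have aux (x1 x2 y1 y2 : littleoh_poly R) :
    \pi_(fermat R) x1 = \pi_(fermat R) x2 ->
    \pi_(fermat R) y1 = \pi_(fermat R) y2 ->
    littleoh_poly_le x1 y1 -> littleoh_poly_le x2 y2.
  move=> xx yy [z [z0 [e e0 le]]]; exists ((x2 - x1) + (y1 - y2) + z); split.
    by rewrite !raddfD !raddfN /= xx yy z0 !subrr !addr0.
  exists e => // t te; have := le t te => /=.
  rewrite -(lerD2l (x2 t - x1 t)) subrK => /le_trans; apply.
  rewrite le_eqVlt; apply/orP; left; apply/eqP.
  by rewrite !fctE /=; ring.
by split; apply: aux; rewrite reprK.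
Qed.

Definition fermat_pos (R : realType) (h : fermat R) : Prop :=
  fermat_le 0 h /\ h <> 0.

Definition is_max (R : realType) (A : set (fermat R)) (m : fermat R) : Prop :=
  A m /\ forall k, A k -> fermat_le k m.

Definition is_min (R : realType) (A : set (fermat R)) (m : fermat R) : Prop :=
  A m /\ forall k, A k -> fermat_le m k.

Definition down (R : realType) (l : fermat R) : set (fermat R) :=
  [set k | fermat_le k l].

Definition up (R : realType) (l : fermat R) : set (fermat R) :=
  [set k | fermat_le l k].

Definition lt_F (R : realType) (x y : fermat R) : Prop :=
  x <> y /\
  [\/ exists l, down l x /\ ~ down l y,
      exists l, is_max (down l) x /\ exists h, fermat_pos h /\ y = x + h
    | exists l, is_min (up l) y /\ exists h, fermat_pos h /\ x = y - h].

(* Asymmetry follows from the first two clauses. *)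
Definition strict_linear_order (T : Type) (lt : T -> T -> Prop) : Prop :=
  [/\ forall x, ~ lt x x,
      forall x y z, lt x y -> lt y z -> lt x z
    & forall x y, x <> y -> lt x y \/ lt y x].

(* Main.v *)
Require Import Defs.
From mathcomp Require Import all_boot all_order all_algebra.
From mathcomp Require Import all_classical all_reals all_analysis.
From mathcomp Require Import lra.
Import Order.TTheory GRing.Theory Num.Theory.
Import numFieldNormedType.Exports.
Local Open Scope classical_set_scope.
Local Open Scope ring_scope.
Local Open Scope quotient_scope.

(** Giordano's order is a linear order, and [lt_F] is its strict part.

    For the second claim, [x < y] gives clause (a) with [l := x].  Conversely,
    in clause (a), [y <= x <= l] is excluded, so [x <= y] by totality; and (b)
    and (c) say outright that [y - x] is a nonnegative element.  Transitivity of
    [lt_F] is thus that of [<=], with antisymmetry excluding [x = z].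

    For the first claim, the unspecified infinitesimal in the definition of the
    order can be taken to be the least possible one: [x <= y] if and only if the
    positive part of [x - y] is [o(t)] ([fermat_le_piE]).  Transitivity and
    antisymmetry follow from the subadditivity of the positive part and from
    [|u| = u^+ + (- u)^+].  Totality is where little-oh polynomials differ from
    arbitrary functions: up to [o(t)], [x - y] is a finite combination of powers
    of [t], whose sign is eventually that of the nonzero term of least exponent
    ([peval_eventual_sign]), so one of the positive parts of [x - y] and [y - x]
    is [o(t)]. *)

(** * Functions negligible with respect to t *)

Section littleo.
Context {R : realType}.
Implicit Types f g : {nonneg R} -> R.

Lemma littleo_t_dominated f g :
  (\forall t \near @zero_right R, `|f t| <= `|g t|) ->
  is_littleo_t g -> is_littleo_t f.
Proof.
move=> fg g0; apply/norm_cvg0P.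
have g0n : `|g t / t%:num| @[t --> @zero_right R] --> (0 : R) by exact/norm_cvg0P.
apply: (squeeze_cvgr _ (cvg_cst 0) g0n); near=> t.
by rewrite normr_ge0 !normrM ler_wpM2r //; near: t.
Unshelve. all: by end_near. Qed.

Lemma littleo_tD {f g} : is_littleo_t f -> is_littleo_t g -> is_littleo_t (f + g).
Proof.
move=> f0 g0; rewrite -[g]opprK; apply: littleo_tB => //.
by apply: littleo_t_dominated g0; apply: nearW => t; rewrite fctE normrN.
Qed.

Lemma littleoh_poly_of_littleo {f} : is_littleo_t f -> f \in @littleoh_poly_pred R.
Proof.
move=> f0; apply/asboolP/littleoh_polyP; exists [::] => //.
rewrite (_ : f - _ = f) //; apply/funext => t.
by rewrite !fctE /peval big_nil subr0.
Qed.

End littleo.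

(** * Eventual sign of a combination of powers *)

Section sign.
Context {R : realType}.
Implicit Types s : seq (R * R).

Lemma exists_min_exponent s : s != [::] ->
  exists2 p, p \in s & forall q, q \in s -> p.2 <= q.2.
Proof.
elim: s => // p [|p' s] IH _.
  by exists p; rewrite ?mem_head // => q; rewrite inE => /eqP->.
have [//|m ms mmin] := IH; have [pm|mp] := leP p.2 m.2.
  exists p; rewrite ?mem_head // => q; rewrite inE => /orP[/eqP->//|/mmin].
  exact: le_trans.
exists m; first by rewrite inE ms orbT.
by move=> q; rewrite inE => /orP[/eqP->|/mmin//]; exact: ltW.
Qed.

Lemma cvg0_peval s : (forall p, p \in s -> 0 < p.2) ->
  peval s t @[t --> @zero_right R] --> (0 : R).
Proof.
elim: s => [_|p s IH s0].
  rewrite (_ : peval [::] = cst 0); first exact: cvg_cst.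
  by apply/funext => t; rewrite /peval big_nil.
rewrite (_ : peval _ = fun t => p.1 * t%:num `^ p.2 + peval s t); last first.
  by apply/funext => t; rewrite /peval big_cons.
rewrite -[X in _ --> X]addr0; apply: cvgD; last first.
  by apply: IH => q qs; apply: s0; rewrite inE qs orbT.
rewrite -[X in _ --> X](mulr0 p.1); apply: cvgM; first exact: cvg_cst.
apply: (@cvg_zero_right _ (fun t => t `^ p.2)).
by apply: powR_cvg0; apply: s0; exact: mem_head.
Qed.

(** Collect the terms of least exponent [a] into [c * t `^ a].  If [c = 0] they
    can be dropped; otherwise [t `^ a] factors out and the cofactor tends to
    [c], whose sign it eventually has. *)
Lemma peval_eventual_sign s :
  (\forall t \near @zero_right R, 0 <= peval s t) \/
  (\forall t \near @zero_right R, peval s t <= 0).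
Proof.
have [n] := ubnP (size s); elim: n s => // n IH s sn.
have [->|/exists_min_exponent[m ms mmin]] := eqVneq s [::].
  by left; apply: nearW => t; rewrite /peval big_nil.
set c := \sum_(p <- s | p.2 == m.2) p.1.
set r := [seq p <- s | p.2 != m.2].
have sE t : peval s t = c * t%:num `^ m.2 + peval r t.
  rewrite /peval (bigID (fun p => p.2 == m.2)) /= big_filter; congr (_ + _).
  by rewrite /c big_distrl /=; apply: eq_bigr => p /eqP->.
have [c0|c0] := eqVneq c 0.
  have rE : peval s = peval r by apply/funext => t; rewrite sE c0 mul0r add0r.
  rewrite rE; apply: IH; rewrite -ltnS; apply: leq_trans sn.
  rewrite ltnS size_filter -(count_predC (fun p => p.2 == m.2) s).
  rewrite -[X in (X < _)%N]add0n ltn_add2r -has_count.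
  by apply/hasP; exists m.
set r' := [seq (p.1, p.2 - m.2) | p <- r].
have r'0 : peval r' t @[t --> @zero_right R] --> (0 : R).
  apply: cvg0_peval => _ /mapP[p pr ->] /=; move: pr.
  by rewrite mem_filter subr_gt0 lt_neqAle eq_sym => /andP[-> /mmin].
have fE : \forall t \near @zero_right R,
    peval s t = t%:num `^ m.2 * (c + peval r' t).
  near=> t; rewrite sE mulrDr mulrC; congr (_ + _).
  rewrite /peval big_map big_distrr /=; apply: eq_bigr => p _.
  have t0 : t%:num != 0 by rewrite gt_eqF //; near: t; exact: zero_right_gt0.
  rewrite mulrCA -powRD; first by rewrite addrC subrK.
  by rewrite t0 implybT.
have cr : c + peval r' t @[t --> @zero_right R] --> c.
  by rewrite -[X in _ --> X]addr0; apply: cvgD => //; exact: cvg_cst.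
have [cneg|cpos] : c < 0 \/ 0 < c by apply/orP; rewrite -neq_lt.
- right; have cr0 : \forall t \near @zero_right R, c + peval r' t < 0.
    exact: cvgr_lt cr _ cneg.
  near=> t; have -> : peval s t = t%:num `^ m.2 * (c + peval r' t) by near: t.
  by rewrite mulr_ge0_le0 ?powR_ge0 // ltW //; near: t.
- left; have cr0 : \forall t \near @zero_right R, 0 < c + peval r' t.
    exact: cvgr_gt cr _ cpos.
  near=> t; have -> : peval s t = t%:num `^ m.2 * (c + peval r' t) by near: t.
  by rewrite mulr_ge0 ?powR_ge0 // ltW //; near: t.
Unshelve. all: by end_near. Qed.

End sign.

(** * The order on Fermat reals *)

Section order.
Context {R : realType}.
Implicit Types (x y z : fermat R) (u v : littleoh_poly R).

Lemma pi_eq0 u : \pi_(fermat R) u = 0 <-> is_littleo_t u.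
Proof.
have -> : (0 : fermat R) = \pi_(fermat R) 0 by rewrite raddf0.
rewrite pi_fermat_eq; suff -> : (fun t => u t - (0 : littleoh_poly R) t) = u by [].
by apply/funext => t; rewrite subr0.
Qed.

(** The positive part of [u - v] is the least function that can serve as the
    infinitesimal correction in [u <= v]. *)
Lemma fermat_le_piE u v : fermat_le (\pi_(fermat R) u) (\pi_(fermat R) v) <->
  is_littleo_t (fun t => Num.max 0 (u t - v t)).
Proof.
rewrite fermat_le_pi; split=> [[z [/pi_eq0 z0 [e e0 uvz]]]|uv].
  apply: littleo_t_dominated z0; near=> t.
  have /uvz : t%:num < e.
    by near: t; exact: (cvgr_lt _ (@cvg_num R) _ e0).
  rewrite ger0_norm ?le_max ?lexx // ge_max normr_ge0 /= lerBlDl => /le_trans.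
  by apply; rewrite lerD2l ler_norm.
exists (LittleohPoly (littleoh_poly_of_littleo uv)); split; first exact/pi_eq0.
by exists 1 => // t _ /=; rewrite -lerBlDl le_max lexx orbT.
Unshelve. all: by end_near. Qed.

Lemma fermat_le_trans x y z : fermat_le x y -> fermat_le y z -> fermat_le x z.
Proof.
elim/quotW: x => u; elim/quotW: y => v; elim/quotW: z => w.
rewrite !fermat_le_piE => uv vw.
apply: littleo_t_dominated (littleo_tD uv vw); apply: nearW => t.
rewrite fctE !ger0_norm ?addr_ge0 ?le_max ?lexx //.
case: (leP 0 (u t - w t)); case: (leP 0 (u t - v t));
  by case: (leP 0 (v t - w t)); lra.
Qed.

Lemma fermat_le_anti x y : fermat_le x y -> fermat_le y x -> x = y.
Proof.
elim/quotW: x => u; elim/quotW: y => v.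
rewrite !fermat_le_piE pi_fermat_eq => uv vu.
apply: littleo_t_dominated (littleo_tD uv vu); apply: nearW => t.
rewrite fctE [leRHS]ger0_norm ?addr_ge0 ?le_max ?lexx // ler_norml.
by case: (leP 0 (u t - v t)); case: (leP 0 (v t - u t)); lra.
Qed.

Lemma fermat_le_total x y : fermat_le x y \/ fermat_le y x.
Proof.
elim/quotW: x => u; elim/quotW: y => v; rewrite !fermat_le_piE.
have /asboolP/littleoh_polyP[s _ uvs] := valP (u - v).
have [s0|s0] := peval_eventual_sign s; [right|left];
  apply: littleo_t_dominated uvs; near=> t;
  rewrite ger0_norm ?le_max ?lexx // ge_max normr_ge0 /=.
- have st : 0 <= peval s t by near: t.
  rewrite -normrN; apply: le_trans (ler_norm _); rewrite !fctE /=.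
  by rewrite !opprB lerDr.
- have st : peval s t <= 0 by near: t.
  by apply: le_trans (ler_norm _); rewrite !fctE /= lerDl oppr_ge0.
Unshelve. all: by end_near. Qed.

Lemma fermat_le_refl x : fermat_le x x.
Proof. by have [] := fermat_le_total x x. Qed.

Lemma fermat_le_addr x h : fermat_le 0 h -> fermat_le x (x + h).
Proof.
elim/quotW: x => u; elim/quotW: h => v.
have -> : (0 : fermat R) = \pi_(fermat R) 0 by rewrite raddf0.
rewrite -raddfD !fermat_le_piE; congr is_littleo_t; apply/funext => t.
by rewrite /= sub0r opprD addrA subrr sub0r.
Qed.

Lemma lt_FE x y : lt_F x y <-> fermat_le x y /\ x <> y.
Proof.
split=> [[xy]|[le_xy xy]]; last first.
  split=> //; apply: Or31; exists x; split; first exact: fermat_le_refl.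
  by move=> yx; apply: xy; exact: fermat_le_anti.
case=> [[l [xl yl]]|[l [_ [h [[h0 _] yE]]]]|[l [_ [h [[h0 _] xE]]]]]; split=> //.
- have [//|yx] := fermat_le_total x y.
  by case: yl; exact: fermat_le_trans yx xl.
- by rewrite yE; exact: fermat_le_addr.
- by rewrite -[y](subrK h) -xE; exact: fermat_le_addr.
Qed.

End order.

Theorem theorem13 (R : realType) : strict_linear_order (@lt_F R).
Proof.
split=> [x [] //|x y z|x y xy].
- rewrite !lt_FE => -[xy nxy] [yz _]; split; first exact: fermat_le_trans yz.
  by move=> xz; apply: nxy; apply: fermat_le_anti => //; rewrite xz.
- rewrite !lt_FE; have [le|le] := fermat_le_total x y; [left|right];
    by split=> // /esym.
Qed.
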